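(* For any given $x^0\in\mathbb{R}^n$ and $\alpha_0>0$, the stepsizes $\{\alpha_k\}$ generated by the general AdaBB algorithm with the choice of $\theta_0$ given in the context satisfy $$\sum_{i=i_0+1}^{k}\alpha_i\ge\frac{k-i_0}{L}\quad\text{for all }k\ge3,$$ where $i_0\in\{0,1,2\}$ is defined in the context. This also implies $$\sum_{i=1}^{k}\alpha_i\ge\frac{k-2+\sqrt2}{L}\quad\text{for all }k\ge1.$$
   Context: $\|\cdot\|$ is the Euclidean norm and $B(x,r)$ the closed ball with center $x$ and radius $r$. $f:\mathbb{R}^n\to\mathbb{R}$ is convex and differentiable with locally Lipschitz gradient; its set of minimizers $\mathcal{X}^*$ is nonempty, $f_*=\min f$, and $x^*\in\mathcal{X}^*$ is fixed. General AdaBB algorithm. Input $x^0\in\mathbb{R}^n$, $\alpha_0>0$, $\theta_0\ge0$. Set $x^1=x^0-\alpha_0\nabla f(x^0)$. For $k=1,2,\dots$ let $$\lambda_k=\frac{\langle\nabla f(x^k)-\nabla f(x^{k-1}),x^k-x^{k-1}\rangle}{\|\nabla f(x^k)-\nabla f(x^{k-1})\|^2}.$$ (Case i) If $\lambda_k\ge\alpha_{k-1}$: $\alpha_k=\sqrt{1+\theta_{k-1}}\,\alpha_{k-1}$ and $\theta_k=\alpha_k/\alpha_{k-1}$. (Case ii) If $\alpha_{k-1}/2<\lambda_k<\alpha_{k-1}$: $\alpha_k=\min\left\{\sqrt{\frac{\lambda_k}{2(\alpha_{k-1}-\lambda_k)}},\sqrt{\frac{(1+\theta_{k-1})\lambda_k}{2\lambda_k-\alpha_{k-1}}}\right\}\alpha_{k-1}$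 (Option I) or $\alpha_k=\lambda_k$ (Option II), and $\theta_k=\frac{2\alpha_k}{\alpha_{k-1}}-\frac{\alpha_k}{\lambda_k}$. (Case iii) If $\lambda_k\le\alpha_{k-1}/2$: $\alpha_k=\sqrt{\frac{\alpha_{k-1}}{2(\alpha_{k-1}-\lambda_k)}}\,\lambda_k$ (Option I) or $\alpha_k=\lambda_k/\sqrt2$ (Option II), and $\theta_k=\alpha_k/\alpha_{k-1}$. Then $x^{k+1}=x^k-\alpha_k\nabla f(x^k)$. In each of Cases ii and iii either option may be selected. It is assumed that $\nabla f(x^k)\ne\nabla f(x^{k-1})$ for all $k\ge1$, so that $\lambda_k$ is well defined. Choice of $\theta_0$ (note $\lambda_1$ depends only on $x^0,\alpha_0$): $\theta_0=\frac{\lambda_1^2}{2\alpha_0^2}-1$ if $\lambda_1\ge\sqrt2\,\alpha_0$, and $\theta_0=0$ otherwise. Define - $M_1=0$, $P_1=\frac{\alpha_1^2}{\alpha_0}$ if $\lambda_1\ge\alpha_0$; - $M_1=\frac{\alpha_1^2}{\lambda_1\alpha_0}-\frac{\alpha_1^2}{\alpha_0^2}$, $P_1=\frac{2\alpha_1^2}{\alpha_0}-\frac{\alpha_1^2}{\lambda_1}$ if $\frac{\alpha_0}2<\lambda_1<\alpha_0$; - $M_1=\frac{\alpha_1^2}{\lambda_1^2}-\frac{\alpha_1^2}{\alpha_0\lambda_1}$, $P_1=\frac{\alpha_1^2}{\alpha_0}$ if $0<\lambda_1\le\frac{\alpha_0}2$. Local smoothness: $L>0$ is such that $f(x)-f(y)-\langle\nabla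 f(y),x-y\rangle\ge\frac1{2L}\|\nabla f(x)-\nabla f(y)\|^2$ for all $x,y\in B(x^*,R)$, where $R^2=\|x^0-x^*\|^2+\alpha_0^2(1+2M_1)\|\nabla f(x^0)\|^2+\max\{2P_1-2\alpha_0,0\}(f(x^0)-f_* )$. Index sets: $I_1=\{k\ge1:\lambda_k\ge\alpha_{k-1}\}$, $I_2=\{k\ge1:\alpha_{k-1}/2<\lambda_k<\alpha_{k-1}\}$, $I_3=\{k\ge1:0<\lambda_k\le\alpha_{k-1}/2\}$. Definition of $i_0$: - $i_0=0$ if $1\in I_2$, or $(1,2)\in I_1\times I_3$, or $(1,2)\in I_3\times I_3$; - $i_0=1$ if $(1,2)\in I_1\times I_1$, or $(1,2)\in I_1\times I_2$, or $(1,2)\in I_3\times I_2$, or $(1,2,3)\in I_3\times I_1\times I_3$; - $i_0=2$ if $(1,2,3)\in I_3\times I_1\times I_1$, or $(1,2,3)\in I_3\times I_1\times I_2$. (Here e.g. $(1,2)\in I_1\times I_3$ means $1\in I_1$ and $2\in I_3$.) *)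

(* Defs.v *)
From HB Require Import structures.
From mathcomp Require Import all_boot all_order all_algebra.
From mathcomp Require Import classical_sets boolp reals topology normedtype.
From mathcomp Require Import derive convex.

Set Implicit Arguments.
Unset Strict Implicit.
Unset Printing Implicit Defensive.

Import Order.TTheory GRing.Theory Num.Theory.
Import numFieldNormedType.Exports.

Local Open Scope classical_set_scope.
Local Open Scope ring_scope.

Definition dot (R : realType) (n : nat) (u v : 'rV[R]_n) : R :=
  \sum_(i < n) u 0 i * v 0 i.

(* The library norm on 'rV[R]_n is the sup norm, hence the Euclidean norm is
   introduced here. Both induce the same topology, so the library's
   [differentiable] and [nbhs] are the usual ones. *)
Definition enorm (R : realType) (n : nat) (u : 'rV[R]_n) : R :=
  Num.sqrt (dot u u).

Definition eball (R : realType) (n : nat) (c : 'rV[R]_n) (r : R) :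
  set 'rV[R]_n := [set z | enorm (z - c) <= r].

Definition grad (R : realType) (n : nat) (f : 'rV[R]_n -> R^o)
  (z : 'rV[R]_n) : 'rV[R]_n := \row_(i < n) 'D_(delta_mx 0 i) f z.

Definition locally_lipschitz (R : realType) (n : nat)
  (g : 'rV[R]_n -> 'rV[R]_n) : Prop :=
  forall z : 'rV[R]_n, exists K : R, exists2 U : set 'rV[R]_n, nbhs z U &
    forall u v, U u -> U v -> enorm (g u - g v) <= K * enorm (u - v).

Definition minimizers (R : realType) (n : nat) (f : 'rV[R]_n -> R^o) :
  set 'rV[R]_n := [set z | forall y, f z <= f y].

(* Meaningful for k >= 1 only. *)
Definition lambda (R : realType) (n : nat) (f : 'rV[R]_n -> R^o)
  (x : nat -> 'rV[R]_n) (k : nat) : R :=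
  dot (grad f (x k) - grad f (x k.-1)) (x k - x k.-1)
  / enorm (grad f (x k) - grad f (x k.-1)) ^+ 2.

(* One update of the stepsizes: [a], [t] stand for alpha_(k-1), theta_(k-1),
   [l] for lambda_k and [a'], [t'] for alpha_k, theta_k. The disjunctions on
   [a'] are Options I and II, which may be chosen afresh at each iteration. *)
Definition adabb_step (R : realType) (l a t a' t' : R) : Prop :=
  [\/ [/\ a <= l,
          a' = Num.sqrt (1 + t) * a
        & t' = a' / a],
      [/\ a / 2 < l < a,
          a' = Num.min (Num.sqrt (l / (2 * (a - l))))
                       (Num.sqrt ((1 + t) * l / (2 * l - a))) * a
          \/ a' = l
        & t' = 2 * a' / a - a' / l]
    | [/\ l <= a / 2,
          a' = Num.sqrt (a / (2 * (a - l))) * l \/ a' = l / Num.sqrt 2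
        & t' = a' / a]].

(* [x], [alpha], [theta] are sequences generated by the general AdaBB algorithm
   on the input x0, alpha0, theta0. *)
Definition adabb (R : realType) (n : nat) (f : 'rV[R]_n -> R^o)
  (x0 : 'rV[R]_n) (alpha0 theta0 : R)
  (x : nat -> 'rV[R]_n) (alpha theta : nat -> R) : Prop :=
  [/\ [/\ x 0%N = x0, alpha 0%N = alpha0 & theta 0%N = theta0],
      forall k, x k.+1 = x k - alpha k *: grad f (x k)
    & forall k, (1 <= k)%N ->
        adabb_step (lambda f x k) (alpha k.-1) (theta k.-1)
          (alpha k) (theta k)].

Definition theta0_choice (R : realType) (l1 a0 : R) : R :=
  if Num.sqrt 2 * a0 <= l1 then l1 ^+ 2 / (2 * a0 ^+ 2) - 1 else 0.

Definition M1 (R : realType) (l1 a0 a1 : R) : R :=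
  if a0 <= l1 then 0
  else if a0 / 2 < l1 then a1 ^+ 2 / (l1 * a0) - a1 ^+ 2 / a0 ^+ 2
  else a1 ^+ 2 / l1 ^+ 2 - a1 ^+ 2 / (a0 * l1).

Definition P1 (R : realType) (l1 a0 a1 : R) : R :=
  if a0 <= l1 then a1 ^+ 2 / a0
  else if a0 / 2 < l1 then 2 * a1 ^+ 2 / a0 - a1 ^+ 2 / l1
  else a1 ^+ 2 / a0.

(* f_* is written f xstar, for a minimizer xstar. *)
Definition adabb_radius (R : realType) (n : nat) (f : 'rV[R]_n -> R^o)
  (xstar x0 : 'rV[R]_n) (l1 a0 a1 : R) : R :=
  Num.sqrt (enorm (x0 - xstar) ^+ 2
    + a0 ^+ 2 * (1 + 2 * M1 l1 a0 a1) * enorm (grad f x0) ^+ 2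
    + Num.max (2 * P1 l1 a0 a1 - 2 * a0) 0 * (f x0 - f xstar)).

Definition locally_smooth (R : realType) (n : nat) (f : 'rV[R]_n -> R^o)
  (B : set 'rV[R]_n) (L : R) : Prop :=
  forall y z, B y -> B z ->
    f y - f z - dot (grad f z) (y - z)
      >= 1 / (2 * L) * enorm (grad f y - grad f z) ^+ 2.

Definition I1 (R : realType) (lam alpha : nat -> R) (k : nat) : bool :=
  (1 <= k)%N && (alpha k.-1 <= lam k).

Definition I2 (R : realType) (lam alpha : nat -> R) (k : nat) : bool :=
  (1 <= k)%N && (alpha k.-1 / 2 < lam k < alpha k.-1).

Definition I3 (R : realType) (lam alpha : nat -> R) (k : nat) : bool :=
  (1 <= k)%N && (0 < lam k <= alpha k.-1 / 2).

(* Since all lambda_k are positive here, every k >= 1 lies in exactly one of the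
   index sets, and the last branch is reached exactly when 1 is in I3, 2 in I1
   and 3 in I1 or I2. *)
Definition i0 (R : realType) (lam alpha : nat -> R) : nat :=
  let I1 := I1 lam alpha in let I2 := I2 lam alpha in
  let I3 := I3 lam alpha in
  if [|| I2 1%N, I1 1%N && I3 2%N | I3 1%N && I3 2%N] then 0%N
  else if [|| I1 1%N && I1 2%N, I1 1%N && I2 2%N, I3 1%N && I2 2%N
            | [&& I3 1%N, I1 2%N & I3 3%N]] then 1%N
  else 2%N.

(* Main.v *)
Require Import Defs.
From HB Require Import structures.
From mathcomp Require Import all_boot all_order all_algebra.
From mathcomp Require Import classical_sets boolp reals topology normedtype.
From mathcomp Require Import derive convex.
From mathcomp Require Import ring lra.

(** Write c = 1/L. The proof has two independent halves.

    Geometry: all iterates stay in the ball on which the smoothness inequality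
    is available, hence every lambda_k is at least c. Along the iteration,
    [adabb_descent] shows that the energy
      |x_(k+1) - x*|^2 + alpha_k^2 |g_k|^2
        + 2 (1 + theta_k) alpha_k (f x_k - f_min)
    does not increase: the stepsize rule is designed so that the coefficients
    created by one step are absorbed by those left by the previous one, which
    is what [P1_le] (P <= (1 + theta) alpha) and [M1_le] (M <= 1/2) say. The
    first step need not be absorbed: the square of the radius of the ball is what
    bounds the energy after it. The argument is an induction,
    [adabb_iterates_in_ball]: the descent inequality for x_(k+2) only involves
    f and its gradient at x_k, x_(k+1) and x*, which already lie in the ball,
    and there the smoothness inequality also provides the subgradient
    inequality.

    Arithmetic: a sequence of stepsizes obeying the update rule with all
    lambda_k >= c has large partial sums. Case ii always gives
    alpha_k >= lambda_k >= c. Case iii may give a stepsize as small as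
    c / sqrt 2, but only after a stepsize at least 2 c, whose surplus c pays for
    the deficit of at most two short steps: after a first short step, case i
    makes theta at least 1, so that a second application of case i multiplies
    the stepsize by at least sqrt 2 and brings it back above c. This bookkeeping
    is the invariant [stepsize_state]. It can be started at any index m with
    alpha_m >= c, and i0 is defined so that m = i0 + 1 is such an index
    ([stepsize_succ_i0_ge]). The second estimate adds the at most two omitted
    stepsizes, each at least c / sqrt 2 ([stepsize_ge_div_sqrt2]). *)

Set Implicit Arguments.
Unset Strict Implicit.
Unset Printing Implicit Defensive.

Import Order.TTheory GRing.Theory Num.Theory.
Import numFieldNormedType.Exports.

Local Open Scope classical_set_scope.
Local Open Scope ring_scope.

(** * The Euclidean inner product *)

Lemma dotC (R : realType) (n : nat) (u v : 'rV[R]_n) : dot u v = dot v u.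
Proof. by apply: eq_bigr => i _; rewrite mulrC. Qed.

Lemma dotDl (R : realType) (n : nat) (u v w : 'rV[R]_n) :
  dot (u + v) w = dot u w + dot v w.
Proof. by rewrite -big_split; apply: eq_bigr => i _; rewrite !mxE mulrDl. Qed.

Lemma dotZl (R : realType) (n : nat) (a : R) (u v : 'rV[R]_n) :
  dot (a *: u) v = a * dot u v.
Proof. by rewrite mulr_sumr; apply: eq_bigr => i _; rewrite !mxE mulrA. Qed.

Lemma dotNl (R : realType) (n : nat) (u v : 'rV[R]_n) :
  dot (- u) v = - dot u v.
Proof. by rewrite -scaleN1r dotZl mulN1r. Qed.

Lemma dotDr (R : realType) (n : nat) (u v w : 'rV[R]_n) :
  dot u (v + w) = dot u v + dot u w.
Proof. by rewrite !(dotC u) dotDl. Qed.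

Lemma dotZr (R : realType) (n : nat) (a : R) (u v : 'rV[R]_n) :
  dot u (a *: v) = a * dot u v.
Proof. by rewrite !(dotC u) dotZl. Qed.

Lemma dotNr (R : realType) (n : nat) (u v : 'rV[R]_n) :
  dot u (- v) = - dot u v.
Proof. by rewrite !(dotC u) dotNl. Qed.

Lemma dot0l (R : realType) (n : nat) (u : 'rV[R]_n) : dot 0 u = 0.
Proof. by have := dotZl 0 0 u; rewrite scale0r mul0r. Qed.

Definition dotE := (dotDl, dotDr, dotZl, dotZr, dotNl, dotNr).

Lemma dot_ge0 (R : realType) (n : nat) (u : 'rV[R]_n) : 0 <= dot u u.
Proof. by apply: sumr_ge0 => i _; rewrite -expr2 sqr_ge0. Qed.

Lemma dot_eq0 (R : realType) (n : nat) (u : 'rV[R]_n) : dot u u = 0 -> u = 0.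
Proof.
move=> /eqP; rewrite psumr_eq0 => [/allP u0|i _]; last by rewrite -expr2 sqr_ge0.
apply/rowP => i; rewrite mxE; apply/eqP.
by have := u0 i (mem_index_enum i); rewrite mulf_eq0 orbb.
Qed.

Lemma enorm_sqr (R : realType) (n : nat) (u : 'rV[R]_n) :
  enorm u ^+ 2 = dot u u.
Proof. by rewrite sqr_sqrtr // dot_ge0. Qed.

Lemma mem_eball_sqrt (R : realType) (n : nat) (c z : 'rV[R]_n) (r : R) :
  dot (z - c) (z - c) <= r -> eball c (Num.sqrt r) z.
Proof. exact: ler_wsqrtr. Qed.

(** * One update of the stepsize *)

Lemma le_sqrtr (R : realType) (u v : R) :
  0 <= u -> u ^+ 2 <= v -> u <= Num.sqrt v.
Proof. by move=> u0 uv; rewrite -(ger0_norm u0) -sqrtr_sqr; apply: ler_wsqrtr. Qed.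

(** Both options of case ii dominate lambda: squared and cleared of denominators,
    the two terms of the minimum in Option I leave (a - l)^2 + l^2 >= 0 and
    t a^2 + (a - l) (a + 2 l) >= 0. *)
Lemma adabb_step_I2_ge (R : realType) (l a t a' t' : R) :
  0 < a -> 0 <= t -> a / 2 < l < a -> adabb_step l a t a' t' -> l <= a'.
Proof.
move=> a0 t0 /andP[l1 l2] [[h _ _]|[_ h _]|[h _ _]]; [lra| |lra].
have l0 : 0 < l by lra.
case: h => ->; last by [].
rewrite -ler_pdivrMr // le_min; apply/andP; split.
  apply: le_sqrtr; first by rewrite divr_ge0 // ltW.
  rewrite ler_pdivlMr; last lra.
  rewrite expr_div_n mulrAC ler_pdivrMr ?exprn_gt0 //.
  suff : 0 <= l * ((a - l) ^+ 2 + l ^+ 2) by lra.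
  by rewrite mulr_ge0 ?addr_ge0 ?sqr_ge0 // ltW.
apply: le_sqrtr; first by rewrite divr_ge0 // ltW.
rewrite ler_pdivlMr; last lra.
rewrite expr_div_n mulrAC ler_pdivrMr ?exprn_gt0 //.
suff : 0 <= l * (t * a ^+ 2 + (a - l) * (a + 2 * l)) by lra.
by rewrite mulr_ge0 ?addr_ge0 ?mulr_ge0 ?sqr_ge0 //; lra.
Qed.

(** Option I of case iii is at least Option II, because a / (2 (a - l)) >= 1/2. *)
Lemma adabb_step_I3_ge (R : realType) (l a t a' t' : R) :
  0 < l -> l <= a / 2 -> adabb_step l a t a' t' -> l / Num.sqrt 2 <= a'.
Proof.
move=> l0 la [[h _ _]|[/andP[h _] _ _]|[_ h _]]; [lra|lra|].
case: h => ->; last by [].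
rewrite mulrC ler_wpM2r ?(ltW l0) // -sqrtrV //; apply: ler_wsqrtr.
by rewrite ler_pdivlMr; lra.
Qed.

Lemma adabb_step_I1E (R : realType) (l a t a' t' : R) :
  0 < a -> a <= l -> adabb_step l a t a' t' ->
  a' = Num.sqrt (1 + t) * a /\ t' = a' / a.
Proof. by move=> a0 la [[]|[/andP[_ h] _ _]|[h _ _]] //; lra. Qed.

Lemma adabb_step_gt0 (R : realType) (l a t a' t' : R) :
  0 < l -> 0 < a -> 0 <= t -> adabb_step l a t a' t' -> 0 < a' /\ 0 <= t'.
Proof.
move=> l0 a0 t0 st; have a'0 : 0 < a'.
  have [h|h] := leP a l.
    have [-> _] := adabb_step_I1E a0 h st.
    by rewrite mulr_gt0 // sqrtr_gt0; lra.
  have [h1|h1] := leP l (a / 2).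
    apply: lt_le_trans (adabb_step_I3_ge l0 h1 st).
    by rewrite divr_gt0 // sqrtr_gt0.
  apply: lt_le_trans (adabb_step_I2_ge a0 t0 _ st) => //.
  by rewrite h1 h.
split=> //; case: st => [[_ _ ->]|[/andP[h _] _ ->]|[_ _ ->]];
  try by rewrite divr_ge0 ?ltW.
have -> : 2 * a' / a - a' / l = (2 * l - a) * a' / (a * l) by field; lra.
by rewrite divr_ge0 ?mulr_ge0 //; lra.
Qed.

(** The weight P of the descent estimate is theta alpha in every case; theta is
    defined for this purpose. *)
Lemma P1_step (R : realType) (l a t a' t' : R) :
  0 < l -> 0 < a -> adabb_step l a t a' t' -> P1 l a a' = t' * a'.
Proof.
move=> l0 a0; rewrite /P1 => -[[h _ ->]|[/andP[h1 h2] _ ->]|[h _ ->]].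
- by rewrite h expr2 mulrAC.
- by rewrite leNgt h2 h1 /=; field; lra.
- have -> : (a <= l) = false by apply/negbTE; rewrite -ltNge; lra.
  by rewrite ltNge h /= expr2 mulrAC.
Qed.

(** With [P1_step], this is the absorption condition for function values. Case i
    and the second term of the minimum in case ii are the largest stepsizes
    that it allows; the other choices are shorter. *)
Lemma P1_le (R : realType) (l a t a' t' : R) :
  0 < l -> 0 < a -> 0 <= t -> adabb_step l a t a' t' ->
  P1 l a a' <= (1 + t) * a.
Proof.
move=> l0 a0 t0; rewrite /P1 => -[[h ha _]|[/andP[h1 h2] ha _]|[h ha _]].
- by rewrite h ha exprMn sqr_sqrtr ?expr2 ?mulrA ?mulfK //; lra.
- have -> : (a <= l) = false by rewrite leNgt h2.
  rewrite h1.
  have -> : 2 * a' ^+ 2 / a - a' ^+ 2 / l = a' ^+ 2 * (2 * l - a) / (a * l).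
    by field; lra.
  rewrite ler_pdivrMr ?mulr_gt0 //.
  case: ha => ->.
    rewrite exprMn; set v := (X in Num.min _ (Num.sqrt X)); set m := Num.min _ _.
    have vE : v * (2 * l - a) = (1 + t) * l by rewrite divfK //; lra.
    have v0 : 0 <= v by rewrite divr_ge0 ?mulr_ge0; lra.
    have mv : m ^+ 2 <= v.
      rewrite -[leRHS]sqr_sqrtr // lerXn2r ?nnegrE ?sqrtr_ge0 //.
        by rewrite le_min !sqrtr_ge0.
      by rewrite ge_min lexx orbT.
    have : m ^+ 2 * (2 * l - a) * a ^+ 2 <= v * (2 * l - a) * a ^+ 2.
      by rewrite ler_wpM2r ?sqr_ge0 // ler_wpM2r //; lra.
    by rewrite vE; lra.
  rewrite -subr_ge0.
  have -> : (1 + t) * a * (a * l) - l ^+ 2 * (2 * l - a) =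
     l * (t * a ^+ 2 + (a - l) * (a + 2 * l)) by ring.
  by rewrite mulr_ge0 ?addr_ge0 ?mulr_ge0 ?sqr_ge0 //; lra.
- have -> : (a <= l) = false by apply/negbTE; rewrite -ltNge; lra.
  rewrite ltNge h /= ler_pdivrMr //.
  have -> : (1 + t) * a * a = a ^+ 2 + t * a ^+ 2 by ring.
  have : 0 <= t * a ^+ 2 by rewrite mulr_ge0 ?sqr_ge0.
  have : 0 <= (a - l) * (a + l) by rewrite mulr_ge0; lra.
  suff : a' ^+ 2 <= l ^+ 2 by lra.
  case: ha => ->; rewrite ?expr_div_n ?exprMn sqr_sqrtr //.
  + rewrite -[leRHS]mul1r ler_wpM2r ?sqr_ge0 //.
    by rewrite ler_pdivrMr; lra.
  + by rewrite divr_ge0; lra.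
  + by have := sqr_ge0 l; lra.
Qed.

(** The absorption condition for squared gradients: the energy contains
    alpha^2 |g|^2 once, while the descent estimate produces 2 M times it. The
    first term of the minimum in case ii, and Option I of case iii, are the
    largest stepsizes that it allows. *)
Lemma M1_le (R : realType) (l a t a' t' : R) :
  0 < l -> 0 < a -> adabb_step l a t a' t' -> M1 l a a' <= 1 / 2.
Proof.
move=> l0 a0; rewrite /M1 => -[[h ha _]|[/andP[h1 h2] ha _]|[h ha _]].
- by rewrite h; lra.
- have -> : (a <= l) = false by rewrite leNgt h2.
  rewrite h1.
  have -> : a' ^+ 2 / (l * a) - a' ^+ 2 / a ^+ 2 =
            a' ^+ 2 * (a - l) / (l * a ^+ 2) by field; lra.
  rewrite ler_pdivrMr ?mulr_gt0 ?exprn_gt0 //.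
  case: ha => ->.
    rewrite exprMn; set v := l / (2 * (a - l)); set m := Num.min _ _.
    have vE : v * (a - l) = l / 2 by rewrite /v; field; lra.
    have v0 : 0 <= v by rewrite divr_ge0; lra.
    have mv : m ^+ 2 <= v.
      rewrite -[leRHS]sqr_sqrtr // lerXn2r ?nnegrE ?sqrtr_ge0 //.
        by rewrite le_min !sqrtr_ge0.
      by rewrite ge_min lexx.
    have : m ^+ 2 * (a - l) * a ^+ 2 <= v * (a - l) * a ^+ 2.
      by rewrite ler_wpM2r ?sqr_ge0 // ler_wpM2r //; lra.
    by rewrite vE; lra.
  rewrite -subr_ge0.
  have -> : 1 / 2 * (l * a ^+ 2) - l ^+ 2 * (a - l) =
     l / 2 * ((a - l) ^+ 2 + l ^+ 2) by field.
  by rewrite mulr_ge0 ?addr_ge0 ?sqr_ge0 //; lra.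
- have -> : (a <= l) = false by apply/negbTE; rewrite -ltNge; lra.
  rewrite ltNge h /=.
  have -> : a' ^+ 2 / l ^+ 2 - a' ^+ 2 / (a * l) =
            a' ^+ 2 * (a - l) / (a * l ^+ 2) by field; lra.
  rewrite ler_pdivrMr ?mulr_gt0 ?exprn_gt0 //.
  case: ha => ->; rewrite ?expr_div_n ?exprMn sqr_sqrtr //.
  + have : a / (2 * (a - l)) * (a - l) = a / 2 by field; lra.
    by move: (a / (2 * (a - l))) => v vE; rewrite mulrAC vE; lra.
  + by rewrite divr_ge0; lra.
  + by have := mulr_ge0 (sqr_ge0 l) (ltW l0); lra.
Qed.

(** Stated for every l: it is used at the first step to show that x0 and x1 lie in
    the ball, before the sign of lambda_1 is known. For l = 0 the division
    convention makes M zero. *)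
Lemma M1_ge0 (R : realType) (l a a' : R) : 0 < a -> 0 <= M1 l a a'.
Proof.
move=> a0; rewrite /M1; have [//|h1] := leP a l; have [h2|h2] := ltP (a / 2) l.
  have l0 : 0 < l by lra.
  have -> : a' ^+ 2 / (l * a) - a' ^+ 2 / a ^+ 2 =
            a' ^+ 2 * (a - l) / (l * a ^+ 2) by field; lra.
  by rewrite divr_ge0 ?(mulr_ge0 (sqr_ge0 _)) ?(mulr_ge0 _ (sqr_ge0 _)) //; lra.
have [->|ln0] := eqVneq l 0; first by rewrite expr0n /= mulr0 invr0 !mulr0 subr0.
have -> : a' ^+ 2 / l ^+ 2 - a' ^+ 2 / (a * l) =
          a' ^+ 2 * (a - l) / (a * l ^+ 2) by field; rewrite ln0 gt_eqF.
by rewrite divr_ge0 ?(mulr_ge0 (sqr_ge0 _)) ?(mulr_ge0 _ (sqr_ge0 _)) //; lra.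
Qed.

Lemma P1_ge0 (R : realType) (l a a' : R) : 0 < l -> 0 < a -> 0 <= P1 l a a'.
Proof.
move=> l0 a0; rewrite /P1; have [h1|h1] := leP a l.
  by rewrite divr_ge0 ?sqr_ge0 // ltW.
have [h2|h2] := ltP (a / 2) l; last by rewrite divr_ge0 ?sqr_ge0 // ltW.
have -> : 2 * a' ^+ 2 / a - a' ^+ 2 / l = a' ^+ 2 * (2 * l - a) / (a * l).
  by field; lra.
by rewrite divr_ge0 ?(mulr_ge0 (sqr_ge0 _)) ?(mulr_ge0 (ltW a0) (ltW l0)) //; lra.
Qed.

(** The next gradient is controlled by the inner product with the previous one,
    later bounded by a decrease of f, and by the previous gradient. The
    hypothesis says that l is the Barzilai-Borwein quotient for the step
    - a h. With c = a / l it determines G = |g|^2 from D = <g, h> and H = |h|^2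
    as G = (2 - c) D + (c - 1) H; this is the estimate itself in case ii. In
    case i, D <= H gives G <= D. In case iii, 2 - c <= 0 is useless with an upper
    bound on D, so D is given the coefficient 1 and the excess (c - 1) (H - D)
    is bounded through H - D <= c H. *)
Lemma gradient_growth (R : realType) (n : nat) (g h : 'rV[R]_n) (l a a' : R) :
  0 < l -> 0 < a ->
  l * dot (g - h) (g - h) = - (a * dot (g - h) h) ->
  a' ^+ 2 * dot g g <=
    P1 l a a' * (a * dot g h) + M1 l a a' * (a ^+ 2 * dot h h).
Proof.
move=> l0 a0.
have := dot_ge0 (g - h).
(* This square is a^2 H - l^2 |g - h|^2; it yields H - D <= c H in case iii. *)
have := dot_ge0 (l *: (g - h) + a *: h).
rewrite !dotE (dotC h g).
move: (dot g g) (dot g h) (dot h h) => G D H k1 k2 k3.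
have a2 := sqr_ge0 a'.
pose c := a / l.
have c0 : 0 < c by rewrite divr_gt0.
have k3' : G = (2 - c) * D + (c - 1) * H.
  apply: (mulfI (lt0r_neq0 l0)).
  have -> : l * ((2 - c) * D + (c - 1) * H) =
            (2 * l - a) * D + (a - l) * H by rewrite /c; field; lra.
  lra.
have DH : D <= H.
  rewrite -subr_ge0 -(pmulr_rge0 _ c0).
  have : l * (c * (H - D)) = a * (H - D) by rewrite /c; field; lra.
  move=> e; rewrite -(pmulr_rge0 _ l0) e.
  have : 0 <= l * (G - 2 * D + H) by rewrite mulr_ge0 ?(ltW l0) //; lra.
  lra.
rewrite /P1 /M1; have [h1|h1] := leP a l.
  rewrite mul0r addr0.
  have -> : a' ^+ 2 / a * (a * D) = a' ^+ 2 * D by field; lra.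
  rewrite ler_wpM2l //.
  have : c <= 1 by rewrite ler_pdivrMr; lra.
  rewrite k3' => c1.
  have : 0 <= (1 - c) * (H - D) by rewrite mulr_ge0; lra.
  lra.
have [h2|h2] := ltP (a / 2) l.
  by rewrite le_eqVlt; apply/orP; left; apply/eqP; rewrite k3' /c; field; lra.
have -> : a' ^+ 2 / a * (a * D) +
  (a' ^+ 2 / l ^+ 2 - a' ^+ 2 / (a * l)) * (a ^+ 2 * H) =
   a' ^+ 2 * (D + c * (c - 1) * H) by rewrite /c; field; lra.
rewrite ler_wpM2l // k3'.
have c1 : 2 <= c by rewrite ler_pdivlMr; lra.
have k4 : H - D <= c * H.
  rewrite -subr_ge0 -(pmulr_rge0 _ (mulr_gt0 l0 a0)).
  have -> : l * a * (c * H - (H - D)) = a ^+ 2 * H - l * (a * (H - D)).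
    by rewrite /c; field; lra.
  have : l * (l * (G - 2 * D + H)) = l * (a * (H - D)) by congr (_ * _); lra.
  lra.
have : 0 <= (c - 1) * (c * H - (H - D)) by rewrite mulr_ge0; lra.
lra.
Qed.

(** * Lower bounds on the stepsizes *)

Lemma sqrt2_inv (R : realType) :
  Num.sqrt 2 = 2 * (Num.sqrt 2)^-1 :> R /\ 1 / 2 <= (Num.sqrt (2 : R))^-1 < 1.
Proof.
have s0 : 0 < Num.sqrt 2 :> R by rewrite sqrtr_gt0.
have s2 : Num.sqrt 2 ^+ 2 = 2 :> R by rewrite sqr_sqrtr.
have r0 : 0 < (Num.sqrt 2)^-1 :> R by rewrite invr_gt0.
have r2 : (Num.sqrt 2)^-1 ^+ 2 = 2^-1 :> R by rewrite exprVn s2.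
split; first by rewrite -{2}s2 expr2 mulfK // gt_eqF.
move: r0 r2; move: (Num.sqrt 2)^-1 => r r0 r2; apply/andP; split.
  by rewrite leNgt; apply/negP => r1; have : r * r < 1 / 2 * (1 / 2);
    [apply: ltr_pM; rewrite ?ltW | move: r2; lra].
rewrite ltNge; apply/negP => r1; have : 1 * 1 <= r * r by rewrite ler_pM.
by move: r2; lra.
Qed.

Lemma adabb_step_I1_ge (R : realType) (l a t a' t' : R) :
  0 < a -> 0 <= t -> a <= l -> adabb_step l a t a' t' -> a <= a' /\ 1 <= t'.
Proof.
move=> a0 t0 la st; have [-> ->] := adabb_step_I1E a0 la st.
have s1 : 1 <= Num.sqrt (1 + t).
  by apply: le_sqrtr => //; rewrite expr1n; lra.
by rewrite mulfK ?gt_eqF // ler_peMl // ltW.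
Qed.

(** The recovery mechanism: once theta >= 1, a step of case i multiplies the
    stepsize by sqrt (1 + theta) >= sqrt 2. *)
Lemma adabb_step_I1_sqrt2 (R : realType) (l a t a' t' c : R) :
  0 < a -> 1 <= t -> a <= l -> adabb_step l a t a' t' ->
  c / Num.sqrt 2 <= a -> c <= a'.
Proof.
move=> a0 t1 la st ca; have [-> _] := adabb_step_I1E a0 la st.
have s0 : 0 < Num.sqrt 2 :> R by rewrite sqrtr_gt0.
move: ca; rewrite ler_pdivrMr // => /le_trans; apply.
by rewrite mulrC (ler_wpM2r (ltW a0)) //; apply: ler_wsqrtr; lra.
Qed.

Lemma theta0_choice_ge0 (R : realType) (l a : R) :
  0 < a -> 0 <= theta0_choice l a.
Proof.
move=> a0; rewrite /theta0_choice; have [h|//] := leP (Num.sqrt 2 * a) l.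
have s2 : Num.sqrt 2 ^+ 2 = 2 :> R by rewrite sqr_sqrtr.
rewrite subr_ge0 ler_pdivlMr ?mul1r; last by rewrite mulr_gt0 ?exprn_gt0.
rewrite -s2 -exprMn lerXn2r // nnegrE ?(le_trans _ h) //.
all: by rewrite mulr_ge0 ?sqrtr_ge0 // ltW.
Qed.

(** The choice of theta_0 makes up for an arbitrarily small alpha_0: when
    lambda_1 is at least sqrt 2 alpha_0, it gives alpha_1 = lambda_1 / sqrt 2
    exactly, and in the rest of case i alpha_0 itself exceeds lambda_1 / sqrt 2. *)
Lemma theta0_choice_step_ge (R : realType) (l a a' t' : R) :
  0 < l -> 0 < a -> adabb_step l a (theta0_choice l a) a' t' ->
  l / Num.sqrt 2 <= a'.
Proof.
move=> l0 a0 st; have t0 := theta0_choice_ge0 l a0.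
have [_ /andP[_ r1]] := sqrt2_inv R.
have s0 : 0 < Num.sqrt 2 :> R by rewrite sqrtr_gt0.
have lr : l / Num.sqrt 2 <= l by rewrite ger_pMr // ltW.
have [h|h] := leP a l; last first.
  have [h1|h1] := leP l (a / 2); first exact: adabb_step_I3_ge st.
  by apply: le_trans lr (adabb_step_I2_ge a0 t0 _ st); rewrite h1 h.
have [aE _] := adabb_step_I1E a0 h st.
have [aa' _] := adabb_step_I1_ge a0 t0 h st.
have [h1|h1] := leP (Num.sqrt 2 * a) l; last first.
  by apply: le_trans aa'; rewrite ler_pdivrMr // mulrC ltW.
rewrite aE /theta0_choice h1 -ler_pdivrMr //; apply: le_sqrtr.
  by rewrite !divr_ge0 ?ltW.
rewrite subrKC !expr_div_n sqr_sqrtr // le_eqVlt; apply/orP; left; apply/eqP.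
by field; lra.
Qed.

(** Invariant relating the current stepsize a, its theta t, and the surplus S, the
    sum of alpha_i - c from a starting index on. Either the step is long, and S
    contains its own surplus a - c, since what came before is nonnegative; or it
    is the first short step after one of length at least 2 c, and
    S >= c + (c / sqrt 2 - c); or it is the second, which adds c / sqrt 2 - c
    again and comes with t >= 1. *)
Definition stepsize_state (R : realType) (c a t S : R) : Prop :=
  [\/ c <= a /\ a - c <= S,
      [/\ a < c, c / Num.sqrt 2 <= a & c / Num.sqrt 2 <= S]
    | [/\ a < c, c / Num.sqrt 2 <= a, 1 <= t & (Num.sqrt 2 - 1) * c <= S]].

Lemma stepsize_state_ge0 (R : realType) (c a t S : R) :
  0 < c -> stepsize_state c a t S -> 0 <= S.
Proof.
move=> c0; have [rE /andP[r1 _]] := sqrt2_inv R.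
case=> [[]|[_ _]|[_ _ _]]; first lra.
all: apply: le_trans; rewrite mulr_ge0 //; lra.
Qed.

(** Short steps come from case i after a short step, or from case iii; the latter
    forces a >= 2 c, hence a long predecessor with surplus at least c. There is
    no third short step in a row by [adabb_step_I1_sqrt2]. *)
Lemma stepsize_state_step (R : realType) (l a t a' t' c S : R) :
  0 < c -> c <= l -> 0 < a -> 0 <= t -> adabb_step l a t a' t' ->
  stepsize_state c a t S -> stepsize_state c a' t' (S + (a' - c)).
Proof.
move=> c0 cl a0 t0 st H; have S0 := stepsize_state_ge0 c0 H.
have grown : c <= a' -> stepsize_state c a' t' (S + (a' - c)).
  by move=> ca'; constructor 1; split=> //; lra.
have [ca'|a'c] := leP c a'; first exact: grown.
have [h|h] := leP a l.
  have [aa' t'1] := adabb_step_I1_ge a0 t0 h st.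
  case: H => [[ca _]|[_ ca cS]|[ac ca t1 _]]; first by lra.
    constructor 3; split=> //; first exact: le_trans aa'.
    have [rE _] := sqrt2_inv R.
    have : (Num.sqrt 2 - 1) * c = c / Num.sqrt 2 + (c / Num.sqrt 2 - c).
      by rewrite {1}rE; ring.
    lra.
  by apply: grown; apply: adabb_step_I1_sqrt2 st ca.
have [h1|h1] := leP l (a / 2); last first.
  apply: grown; apply: le_trans cl _.
  by apply: adabb_step_I2_ge st => //; rewrite h1 h.
have a'r : c / Num.sqrt 2 <= a'.
  apply: le_trans (adabb_step_I3_ge _ h1 st); last lra.
  by rewrite ler_wpM2r // invr_ge0 sqrtr_ge0.
by case: H => [[ca aS]|[ac _ _]|[ac _ _ _]]; [constructor 2; split=> //; lra|lra|lra].
Qed.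

Lemma adabb_pos (R : realType) (lam alpha theta : nat -> R) :
  0 < alpha 0%N -> 0 <= theta 0%N ->
  (forall k, 0 < lam k.+1) ->
  (forall k, adabb_step (lam k.+1) (alpha k) (theta k)
               (alpha k.+1) (theta k.+1)) ->
  forall k, 0 < alpha k /\ 0 <= theta k.
Proof.
move=> a0 t0 lam0 st; elim=> [//|k [ak tk]].
exact: adabb_step_gt0 (st k).
Qed.

Lemma stepsize_sum_ge (R : realType) (lam alpha theta : nat -> R) (c : R) m k :
  0 < c -> (forall j, c <= lam j.+1) ->
  (forall j, 0 < alpha j /\ 0 <= theta j) ->
  (forall j, adabb_step (lam j.+1) (alpha j) (theta j)
               (alpha j.+1) (theta j.+1)) ->
  c <= alpha m -> (m <= k.+1)%N ->
  (k.+1%:R - m%:R) * c <= \sum_(m <= i < k.+1) alpha i.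
Proof.
move=> c0 cl pos st cm mk.
have -> : (k.+1%:R - m%:R) * c = \sum_(m <= i < k.+1) c.
  by rewrite sumr_const_nat -natrB // mulr_natl.
rewrite -subr_ge0 -sumrB.
move: mk; rewrite leq_eqVlt => /predU1P[->|mk]; first by rewrite big_geq.
suff : stepsize_state c (alpha k) (theta k) (\sum_(m <= i < k.+1) (alpha i - c)).
  exact: stepsize_state_ge0.
rewrite ltnS in mk; rewrite -(subnKC mk); elim: (k - m)%N => [|j IH].
  by rewrite addn0 big_nat1; constructor 1.
rewrite addnS big_nat_recr /=; last by rewrite leqW // leq_addr.
have [aj tj] := pos (m + j)%N.
exact: stepsize_state_step (cl _) aj tj (st _) IH.
Qed.

(** Case i never decreases the stepsize, and cases ii and iii restart it above
    lambda / sqrt 2. *)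
Lemma stepsize_ge_div_sqrt2 (R : realType) (lam alpha theta : nat -> R) (c : R) :
  0 < c -> (forall j, c <= lam j.+1) ->
  (forall j, 0 < alpha j /\ 0 <= theta j) ->
  (forall j, adabb_step (lam j.+1) (alpha j) (theta j)
               (alpha j.+1) (theta j.+1)) ->
  theta 0%N = theta0_choice (lam 1%N) (alpha 0%N) ->
  forall k, c / Num.sqrt 2 <= alpha k.+1.
Proof.
move=> c0 cl pos st t0E.
have [_ /andP[_ r1]] := sqrt2_inv R.
have r0 : 0 <= (Num.sqrt 2)^-1 :> R by rewrite invr_ge0 sqrtr_ge0.
have clr j : c / Num.sqrt 2 <= lam j.+1 / Num.sqrt 2 by rewrite ler_wpM2r.
elim=> [|k IH].
  apply: le_trans (clr 0%N) _; have := st 0%N; rewrite t0E.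
  apply: theta0_choice_step_ge; first exact: lt_le_trans (cl _).
  by have [] := pos 0%N.
have [ak tk] := pos k.+1; have stk := st k.+1.
have lk : 0 < lam k.+2 by apply: lt_le_trans (cl _).
have [h|h] := leP (alpha k.+1) (lam k.+2).
  by apply: le_trans IH _; have [] := adabb_step_I1_ge ak tk h stk.
apply: le_trans (clr k.+1) _.
have [h1|h1] := leP (lam k.+2) (alpha k.+1 / 2).
  exact: adabb_step_I3_ge stk.
apply: le_trans (adabb_step_I2_ge ak tk _ stk); last by rewrite h1 h.
by rewrite ger_pMr // ltW.
Qed.

Lemma i0_le2 (R : realType) (lam alpha : nat -> R) : (i0 lam alpha <= 2)%N.
Proof. by rewrite /i0; case: ifP => // _; case: ifP. Qed.

(** Why i0 is defined as it is: alpha_j >= c holds when j is in I2, when j + 1 is in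
    I3 (then alpha_j >= 2 lambda_(j+1)), and when j - 1 and j are both in I1 (then
    theta_(j-1) >= 1). Each branch of i0 exhibits one of these patterns at
    j = i0 + 1. *)
Lemma stepsize_succ_i0_ge (R : realType) (lam alpha theta : nat -> R) (c : R) :
  0 < c -> (forall j, c <= lam j.+1) ->
  (forall j, 0 < alpha j /\ 0 <= theta j) ->
  (forall j, adabb_step (lam j.+1) (alpha j) (theta j)
               (alpha j.+1) (theta j.+1)) ->
  theta 0%N = theta0_choice (lam 1%N) (alpha 0%N) ->
  c <= alpha (i0 lam alpha).+1.
Proof.
move=> c0 cl pos st t0E.
have ge_r := stepsize_ge_div_sqrt2 c0 cl pos st t0E.
have via2 j : I2 lam alpha j.+1 -> c <= alpha j.+1.
  move=> h; have [aj tj] := pos j.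
  exact: le_trans (cl j) (adabb_step_I2_ge aj tj h (st j)).
have via3 j : I3 lam alpha j.+1 -> c <= alpha j.
  by move=> /= /andP[_ h]; have := cl j; move: h => /=; lra.
have via11 j : I1 lam alpha j.+1 -> I1 lam alpha j.+2 -> c <= alpha j.+2.
  move=> h1 h2; have [aj tj] := pos j; have [aj' _] := pos j.+1.
  have [_ t1] := adabb_step_I1_ge aj tj h1 (st j).
  exact: adabb_step_I1_sqrt2 aj' t1 h2 (st j.+1) (ge_r j).
have cover j : [|| I1 lam alpha j.+1, I2 lam alpha j.+1 | I3 lam alpha j.+1].
  rewrite /I1 /I2 /I3 /= (lt_le_trans c0 (cl j)) /=.
  have [//|_] := leP (alpha j) (lam j.+1).
  by have [] := ltP (alpha j / 2) (lam j.+1).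
rewrite /i0; case: ifP => [/or3P[/via2//|/andP[_ /via3]//|/andP[_ /via3]//]|].
move=> /norP[n2 /norP[n13 n33]].
case: ifP => [/or4P[/andP[h1 h2]|/andP[_ /via2]|/andP[_ /via2]|]|].
- exact: via11 h1 h2.
- exact.
- exact.
- by case/and3P => _ _ /via3.
move=> /norP[n11 /norP[n12 /norP[n32 n313]]].
have := cover 0%N; have := cover 1%N; have := cover 2%N.
move: n2 n13 n33 n11 n12 n32 n313 (via2 2%N) (via11 1%N).
move: (I1 _ _ 1) (I1 _ _ 2) (I1 _ _ 3) (I2 _ _ 1) (I2 _ _ 2) (I2 _ _ 3).
move: (I3 _ _ 1) (I3 _ _ 2) (I3 _ _ 3).
(* What remains is propositional in the memberships of 1, 2 and 3. *)
by do 9!case; move=> //= *; auto.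
Qed.

(** * The iterates stay in the ball *)

Lemma locally_smooth_subgradient (R : realType) (n : nat) (f : 'rV[R]_n -> R^o)
    (B : set 'rV[R]_n) (L : R) (y z : 'rV[R]_n) :
  0 < L -> locally_smooth f B L -> B y -> B z ->
  dot (grad f z) (y - z) <= f y - f z.
Proof.
move=> L0 sm By Bz; rewrite -subr_ge0; apply: le_trans (sm _ _ By Bz).
by rewrite mulr_ge0 ?sqr_ge0 // divr_ge0 // mulr_ge0 // ltW.
Qed.

(** Adding the smoothness inequalities for (x_k, x_(k-1)) and (x_(k-1), x_k) gives
    cocoercivity of the gradient, which bounds the quotient lambda_k. *)
Lemma lambda_ge (R : realType) (n : nat) (f : 'rV[R]_n -> R^o)
    (B : set 'rV[R]_n) (L : R) (x : nat -> 'rV[R]_n) (k : nat) :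
  0 < L -> locally_smooth f B L -> B (x k) -> B (x k.-1) ->
  grad f (x k) <> grad f (x k.-1) -> 1 / L <= lambda f x k.
Proof.
move=> L0 sm Bk Bk1 gn; rewrite /lambda enorm_sqr.
have d0 : 0 < dot (grad f (x k) - grad f (x k.-1)) (grad f (x k) - grad f (x k.-1)).
  rewrite lt_def dot_ge0 andbT; apply/eqP => /dot_eq0 /eqP.
  by rewrite subr_eq0 => /eqP.
rewrite ler_pdivlMr //.
have c2 : 1 / (2 * L) = 1 / L / 2 by field; lra.
have := sm _ _ Bk1 Bk; rewrite enorm_sqr c2 => sm10.
have := sm _ _ Bk Bk1; rewrite enorm_sqr c2; move: sm10.
move: (1 / L) (f (x k)) (f (x k.-1)) => c p q.
move: (grad f (x k)) (grad f (x k.-1)) => g h; move: (x k) (x k.-1) => u v.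
rewrite !dotE (dotC h g); lra.
Qed.

(** For consecutive points u, v, w: expanding |w - s|^2 produces
    - 2 a' <g, v - s> <= - 2 a' (f v - f s) and a'^2 |g|^2. The latter is written as
    2 a'^2 |g|^2 - a'^2 |g|^2: the negative copy moves to the left, where it will
    absorb the next step, and the other two are bounded by [gradient_growth]. *)
Lemma adabb_descent (R : realType) (n : nat) (f : 'rV[R]_n -> R^o)
    (B : set 'rV[R]_n) (L l a a' : R) (s u v w : 'rV[R]_n) :
  0 < L -> locally_smooth f B L -> B s -> B u -> B v ->
  0 < l -> 0 < a -> 0 < a' ->
  v = u - a *: grad f u -> w = v - a' *: grad f v ->
  l * dot (grad f v - grad f u) (grad f v - grad f u)
    = dot (grad f v - grad f u) (v - u) ->
  dot (w - s) (w - s) + a' ^+ 2 * dot (grad f v) (grad f v)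
    + 2 * (a' + P1 l a a') * (f v - f s)
  <= dot (v - s) (v - s) + 2 * M1 l a a' * (a ^+ 2 * dot (grad f u) (grad f u))
    + 2 * P1 l a a' * (f u - f s).
Proof.
move=> L0 sm Bs Bu Bv l0 a0 a'0 vE wE lE.
have vu : v - u = - (a *: grad f u) by rewrite vE addrAC subrr add0r.
have /(gradient_growth a' l0 a0) :
    l * dot (grad f v - grad f u) (grad f v - grad f u)
    = - (a * dot (grad f v - grad f u) (grad f u)).
  by rewrite lE vu dotNr dotZr.
have uv : dot (grad f v) (u - v) = a * dot (grad f v) (grad f u).
  by rewrite -opprB vu opprK dotZr.
have := locally_smooth_subgradient L0 sm Bu Bv.
rewrite uv => /(ler_wpM2l (P1_ge0 a' l0 a0)).
have := locally_smooth_subgradient L0 sm Bs Bv.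
move=> /(ler_wpM2l (ltW a'0)).
have -> : w - s = (v - s) - a' *: grad f v by rewrite wE; exact: addrAC.
have -> : s - v = - (v - s) by rewrite opprB.
move: (P1 l a a') (M1 l a a') (f s) (f u) (f v) (v - s) => P M fs fu fv d.
move: (grad f u) (grad f v) => h g.
rewrite !dotE (dotC d); lra.
Qed.

(** Membership of x_k and x_(k+1) yields lambda_(k+1) > 0, hence the sign of
    alpha_(k+1) and theta_(k+1), hence the descent inequality, hence membership of
    x_(k+2); so these facts are proved by one simultaneous induction. *)
Lemma adabb_iterates_in_ball (R : realType) (n : nat) (f : 'rV[R]_n -> R^o)
    (xstar x0 : 'rV[R]_n) (alpha0 theta0 L : R)
    (x : nat -> 'rV[R]_n) (alpha theta : nat -> R) :
  minimizers f xstar -> 0 < alpha0 -> 0 <= theta0 ->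
  adabb f x0 alpha0 theta0 x alpha theta ->
  (forall k, grad f (x k.+1) <> grad f (x k)) -> 0 < L ->
  let r := adabb_radius f xstar x0 (lambda f x 1%N) alpha0 (alpha 1%N) in
  locally_smooth f (eball xstar r) L -> forall k, eball xstar r (x k).
Proof.
move=> xmin a00 t00 [[x0E a0E t0E] xS stS] gn L0.
rewrite /adabb_radius !enorm_sqr.
set R2 := (X in Num.sqrt X).
have F_ge0 k : 0 <= f (x k) - f xstar by rewrite subr_ge0 xmin.
have max0 y : 0 <= Num.max y 0 :> R by rewrite le_max lexx orbT.
have R2E : R2 = dot (x0 - xstar) (x0 - xstar)
  + alpha0 ^+ 2 * (1 + 2 * M1 (lambda f x 1) alpha0 (alpha 1%N))
      * dot (grad f x0) (grad f x0)
  + Num.max (2 * P1 (lambda f x 1) alpha0 (alpha 1%N) - 2 * alpha0) 0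
      * (f x0 - f xstar) by [].
move: R2 R2E => R2 R2E; set B := eball _ _ => sm.
have R2_ge : dot (x0 - xstar) (x0 - xstar)
    + alpha0 ^+ 2 * dot (grad f x0) (grad f x0) <= R2.
  have M0 := M1_ge0 (lambda f x 1) (alpha 1%N) a00.
  have := mulr_ge0 (max0 (2 * P1 (lambda f x 1) alpha0 (alpha 1%N) - 2 * alpha0))
                   (F_ge0 0%N).
  have := mulr_ge0 M0 (mulr_ge0 (sqr_ge0 alpha0) (dot_ge0 (grad f x0))).
  rewrite x0E R2E; lra.
have Bs : B xstar.
  apply: mem_eball_sqrt; rewrite subrr dot0l; apply: le_trans R2_ge.
  by rewrite addr_ge0 ?dot_ge0 ?(mulr_ge0 (sqr_ge0 _) (dot_ge0 _)).
have Bx0 : B (x 0%N).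
  apply: mem_eball_sqrt; rewrite x0E; apply: le_trans R2_ge.
  by rewrite lerDl (mulr_ge0 (sqr_ge0 _) (dot_ge0 _)).
have x1_le : dot (x 1%N - xstar) (x 1%N - xstar) + 2 * alpha0 * (f x0 - f xstar)
    <= dot (x0 - xstar) (x0 - xstar) + alpha0 ^+ 2 * dot (grad f x0) (grad f x0).
  have := locally_smooth_subgradient L0 sm Bs Bx0.
  rewrite x0E => /(ler_wpM2l (ltW a00)).
  have -> : x 1%N - xstar = (x0 - xstar) - alpha0 *: grad f x0.
    by rewrite xS a0E x0E addrAC.
  have -> : xstar - x0 = - (x0 - xstar) by rewrite opprB.
  move: (x0 - xstar) => d; rewrite !dotE (dotC d); lra.
have Bx1 : B (x 1%N).
  apply: mem_eball_sqrt; apply: le_trans R2_ge; apply: le_trans x1_le.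
  by rewrite lerDl -x0E !mulr_ge0 // ltW.
(* The energy bound starts at k = 1: the step from x0 is paid for by the radius. *)
suff inv k : [/\ B (x k), B (x k.+1), 0 < alpha k, 0 <= theta k
   & (0 < k)%N -> dot (x k.+1 - xstar) (x k.+1 - xstar)
       + alpha k ^+ 2 * dot (grad f (x k)) (grad f (x k))
       + 2 * ((1 + theta k) * alpha k) * (f (x k) - f xstar) <= R2].
  by move=> k; have [] := inv k.
elim: k => [|k [Bk Bk1 ak tk Ek]]; first by rewrite a0E t0E.
have lk : 0 < lambda f x k.+1.
  by apply: lt_le_trans (lambda_ge L0 sm Bk1 Bk (gn k)); rewrite divr_gt0.
have stk := stS k.+1 isT; rewrite /= in stk.
have [ak1 tk1] := adabb_step_gt0 lk ak tk stk.
have lE : lambda f x k.+1 * dot (grad f (x k.+1) - grad f (x k))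
     (grad f (x k.+1) - grad f (x k))
   = dot (grad f (x k.+1) - grad f (x k)) (x k.+1 - x k).
  rewrite /lambda enorm_sqr /= divfK //; apply/eqP => /dot_eq0 /eqP.
  by rewrite subr_eq0 => /eqP; apply: gn.
have := adabb_descent L0 sm Bs Bk Bk1 lk ak ak1 (xS k) (xS k.+1) lE.
have PE := P1_step lk ak stk.
have -> : 2 * (alpha k.+1 + P1 (lambda f x k.+1) (alpha k) (alpha k.+1))
   = 2 * ((1 + theta k.+1) * alpha k.+1) by rewrite PE; ring.
move=> desc.
have Ek1 : dot (x k.+2 - xstar) (x k.+2 - xstar)
       + alpha k.+1 ^+ 2 * dot (grad f (x k.+1)) (grad f (x k.+1))
       + 2 * ((1 + theta k.+1) * alpha k.+1) * (f (x k.+1) - f xstar) <= R2.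
  apply: le_trans desc _; case: k => [|k] in ak tk lk stk Ek {Bk Bk1 ak1 tk1 lE PE} *.
    rewrite x0E a0E R2E.
    have : (2 * P1 (lambda f x 1) alpha0 (alpha 1%N) - 2 * alpha0)
        * (f x0 - f xstar)
      <= Num.max (2 * P1 (lambda f x 1) alpha0 (alpha 1%N) - 2 * alpha0) 0
        * (f x0 - f xstar).
      by rewrite ler_wpM2r ?le_max ?lexx // -x0E.
    move: (Num.max _ _) x1_le => m; lra.
  apply: le_trans (Ek isT).
  have P := ler_wpM2r (F_ge0 k.+1) (P1_le lk ak tk stk).
  have M := ler_wpM2r (mulr_ge0 (sqr_ge0 (alpha k.+1)) (dot_ge0 (grad f (x k.+1))))
    (M1_le lk ak stk).
  move: P M.
  move: (alpha k.+1) (theta k.+1) (P1 _ _ _) (M1 _ _ _) (f (x k.+1) - f xstar)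
    (alpha k.+1 ^+ 2 * dot (grad f (x k.+1)) (grad f (x k.+1)))
    (dot (x k.+2 - xstar) (x k.+2 - xstar)).
  by move=> a t p m F X V; lra.
split=> //; apply: mem_eball_sqrt; apply: le_trans Ek1.
have F_term : 0 <= 2 * ((1 + theta k.+1) * alpha k.+1) * (f (x k.+1) - f xstar).
  apply: (mulr_ge0 _ (F_ge0 k.+1)); apply: mulr_ge0; first exact: ler0n.
  exact: mulr_ge0 (addr_ge0 ler01 tk1) (ltW ak1).
rewrite -addrA lerDl; apply: (addr_ge0 _ F_term).
exact: mulr_ge0 (sqr_ge0 _) (dot_ge0 _).
Qed.

Theorem theorem4p1 (R : realType) (n : nat) (f : 'rV[R]_n -> R^o)
    (xstar x0 : 'rV[R]_n) (alpha0 L : R)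
    (x : nat -> 'rV[R]_n) (alpha theta : nat -> R)
    (f_convex : convex_function setT f)
    (f_diff : forall z, differentiable f z)
    (f_lip : locally_lipschitz (grad f))
    (xstar_min : minimizers f xstar)
    (alpha0_gt0 : 0 < alpha0)
    (generated : adabb f x0 alpha0 (theta0_choice (lambda f x 1%N) alpha0)
                   x alpha theta)
    (grad_neq : forall k, (1 <= k)%N -> grad f (x k) <> grad f (x k.-1))
    (L_gt0 : 0 < L)
    (L_smooth : locally_smooth f
       (eball xstar (adabb_radius f xstar x0 (lambda f x 1%N) alpha0 (alpha 1%N))) L) :
  (forall k, (3 <= k)%N ->
     \sum_((i0 (lambda f x) alpha).+1 <= i < k.+1) alpha i
       >= (k%:R - (i0 (lambda f x) alpha)%:R) / L)
  /\
  (forall k, (1 <= k)%N ->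
     \sum_(1 <= i < k.+1) alpha i >= (k%:R - 2 + Num.sqrt 2) / L).
Proof.
have th0 := theta0_choice_ge0 (lambda f x 1%N) alpha0_gt0.
have inB := adabb_iterates_in_ball xstar_min alpha0_gt0 th0 generated
  (fun k => grad_neq k.+1 isT) L_gt0 L_smooth.
have [[x0E a0E t0E] xS stS] := generated.
have c0 : 0 < 1 / L by rewrite divr_gt0.
have lam_ge j : 1 / L <= lambda f x j.+1.
  exact: lambda_ge L_gt0 L_smooth (inB _) (inB _) (grad_neq _ _).
have st j := stS j.+1 isT; rewrite /= in st.
have pos : forall j, 0 < alpha j /\ 0 <= theta j.
  apply: (adabb_pos _ _ _ st); rewrite ?a0E ?t0E // => j.
  exact: lt_le_trans (lam_ge j).
have t0E' : theta 0%N = theta0_choice (lambda f x 1%N) (alpha 0%N).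
  by rewrite t0E a0E.
have ge_r := stepsize_ge_div_sqrt2 c0 lam_ge pos st t0E'.
have start := stepsize_succ_i0_ge c0 lam_ge pos st t0E'.
have i02 := i0_le2 (lambda f x) alpha.
move: (i0 _ _) start i02 => i start i2.
have tail k : (i <= k)%N ->
    (k%:R - i%:R) / L <= \sum_(i.+1 <= j < k.+1) alpha j.
  move=> ik; have := stepsize_sum_ge c0 lam_ge pos st start ik.
  by rewrite -!natr1 opprD addrACA subrr addr0 mul1r.
have head m : m%:R * (1 / L / Num.sqrt 2) <= \sum_(1 <= j < m.+1) alpha j.
  have -> : m%:R * (1 / L / Num.sqrt 2) = \sum_(1 <= j < m.+1) 1 / L / Num.sqrt 2.
    by rewrite sumr_const_nat subSS subn0 mulr_natl.
  by apply: ler_sum_nat => -[|j] //= _; exact: ge_r.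
split=> k k1; first by apply: tail; exact: leq_trans i2 (ltnW k1).
have [rE /andP[_ r1]] := sqrt2_inv R.
(* The number of omitted steps, or k itself when k < i0, is at most 2; for m
   such steps the difference of the two sides is (2 - m) (1 - 1 / sqrt 2) c. *)
have short m : (m <= 2)%N ->
    (m%:R - 2 + Num.sqrt 2) / L <= m%:R * (1 / L / Num.sqrt 2).
  move=> m2; have -> : m%:R * (1 / L / Num.sqrt 2) = m%:R / Num.sqrt 2 / L.
    by rewrite mul1r [L^-1 / _]mulrC mulrA.
  rewrite ler_pM2r ?invr_gt0 // {1}rE.
  have : 0 <= (2 - m%:R) * (1 - (Num.sqrt (2 : R))^-1).
    by rewrite mulr_ge0 ?subr_ge0 ?ler_nat // ltW.
  lra.
have [ik|ki] := leqP i k; last first.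
  by apply: le_trans (head k); apply: short; exact: leq_trans (ltnW ki) i2.
rewrite (@big_cat_nat _ _ _ i.+1) //=.
apply: le_trans (lerD (head i) (tail k ik)).
apply: le_trans (lerD (short i i2) (lexx _)).
by rewrite -mulrDl ler_pM2r ?invr_gt0 //; lra.
Qed.
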